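(* $\mathbf{LogDCFL}\subseteq\mathbf{SLogCFL}\subseteq\mathbf{LogCFL}$.
   Context: $\mathbf{LogCFL}$ (resp. $\mathbf{LogDCFL}$) is the class of languages logspace-reducible to a context-free (resp. deterministic context-free) language; equivalently, languages accepted by nondeterministic (resp. deterministic) auxiliary pushdown automata with $O(\log n)$ space and polynomial time. An auxiliary pushdown automaton (AuxPDA) is a multi-tape Turing machine with a two-way read-only input tape, $l$ tapes including work tapes, and a pushdown tape; space counts only work-tape cells. Its transitions are tuples $(p,\mathcal{S},t_1,\dots,t_l,q)$ with states $p,q$, a stack triple $\mathcal{S}$ and tape triples $t_i$. A tape triple is either $(ab,D,cd)$ with tape symbols $a,b,c,d$ and $D\in\{+1,-1\}$ (for $D=+1$: if the head scans $a$ and the cell to its right holds $b$, rewrite them as $c,d$ and move right; for $D=-1$: the scanned symbol is $b$ with $a$ to its left, rewritten as $d$ and $c$ respectively, and the head moves left), or $(a,0,b)$ (replace scanned $a$ by $b$ without moving). A stack triple is either $(\alpha_a\alpha_b,P,\alpha_c\alpha_d)$ with pushdown symbols and $P\in\{+1,-1\}$ ($+1$ a push, $-1$ a pop, defined analogously) or $(\alpha_a,0,\alpha_b)$. The inverse of $\delta=(p,\mathcal{S},t_1,\dots,t_l,q)$ is $\delta^{-1}=(q,\mathcal{S}^{-1},t_1^{-1},\dots,t_l^{-1},p)$, where $(x,D,y)^{-1}=(y,-D,x)$. An AuxPDA is symmetric if its set of transitions is closed under taking inverses. $\mathbf{SLogCFL}$ is the class of languages accepted by $O(\log n)$-space-bounded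 and polynomial-time-bounded symmetric AuxPDAs. *)

(* Defs.v *)
From HB Require Import structures.
From mathcomp Require Import all_boot all_order all_algebra.
From mathcomp Require Import boolp classical_sets.

Set Implicit Arguments.
Unset Strict Implicit.
Unset Printing Implicit Defensive.

Import GRing.Theory.
Local Open Scope ring_scope.
Local Open Scope classical_set_scope.

(* [Shift a b D c d] is (ab, D, cd), with [D = true] for +1 and [D = false] for
   -1; [Stay a b] is (a, 0, b). *)
Inductive triple (A : Type) : Type :=
| Shift of A & A & bool & A & A
| Stay of A & A.

Section TripleFinite.
Variable A : Type.

Definition triple_code (t : triple A) : A * A * bool * A * A + A * A :=
  match t with
  | Shift a b D c d => inl (a, b, D, c, d)
  | Stay a b => inr (a, b)
  end.

Definition triple_decode (u : A * A * bool * A * A + A * A) : triple A :=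
  match u with
  | inl (a, b, D, c, d) => Shift a b D c d
  | inr (a, b) => Stay a b
  end.

Lemma triple_codeK : cancel triple_code triple_decode.
Proof. by case. Qed.

End TripleFinite.

HB.instance Definition _ (A : finType) :=
  Finite.copy (triple A) (can_type (@triple_codeK A)).

Definition inv_triple (A : Type) (t : triple A) : triple A :=
  match t with
  | Shift a b D c d => Shift c d (~~ D) a b
  | Stay a b => Stay b a
  end.

Definition read_only (A : Type) (t : triple A) : Prop :=
  match t with
  | Shift a b _ c d => a = c /\ b = d
  | Stay a b => a = b
  end.

(* (p, S, (t_1, ..., t_l), q).  The symbol [None] in a stack triple is the blank
   that fills the pushdown tape above its top. *)
Definition transition (Q P G : Type) (l : nat) : Type :=
  (Q * triple (option P) * {ffun 'I_l -> triple G} * Q)%type.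

Definition inv_transition (Q P G : Type) (l : nat) (d : transition Q P G l) :
    transition Q P G l :=
  let: (p, sg, t, q) := d in
  (q, inv_triple sg, [ffun i => inv_triple (t i)], p).

(* There are [nwork.+1] tapes: tape [ord0] is the read-only input tape, the
   others are work tapes. *)
Record auxPDA (Sigma : finType) : Type := AuxPDA {
  state : finType;
  psym : finType;
  tsym : finType;
  nwork : nat;
  blank : tsym;
  emb : Sigma -> tsym;
  bottom : psym;
  start : state;
  final : {set state};
  delta : {set transition state psym tsym nwork.+1};
  emb_inj : injective emb;
  emb_neq_blank : forall a, emb a <> blank;
  delta_read_only :
    forall p sg t q, (p, sg, t, q) \in delta -> read_only (t ord0)
}.

(* A two-way infinite tape: its contents and the position of its head. *)
Record tape (G : Type) : Type := Tape { cell : int -> G; head : int }.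

Definition write (G : Type) (f : int -> G) (i : int) (a : G) : int -> G :=
  fun j => if j == i then a else f j.

Definition tape_step (G : Type) (t : triple G) (T T' : tape G) : Prop :=
  let f := cell T in let h := head T in
  match t with
  | Shift a b true c d =>
      [/\ f h = a, f (h + 1) = b &
          T' = Tape (write (write f h c) (h + 1) d) (h + 1)]
  | Shift a b false c d =>
      [/\ f (h - 1) = a, f h = b &
          T' = Tape (write (write f (h - 1) c) h d) (h - 1)]
  | Stay a b => f h = a /\ T' = Tape (write f h b) h
  end.

(* The pushdown is a list with its top first.  A push finds the blank above the
   top and a pop must restore it; a stack triple of any other shape can never
   apply, as the cells up to the top are never blank. *)
Definition stack_step (P : Type) (sg : triple (option P)) (s s' : seq P) : Prop :=
  match sg with
  | Shift (Some a) None true (Some c) (Some d) =>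
      exists r, s = a :: r /\ s' = d :: c :: r
  | Shift (Some a) (Some b) false (Some c) None =>
      exists r, s = b :: a :: r /\ s' = c :: r
  | Stay (Some a) (Some b) => exists r, s = a :: r /\ s' = b :: r
  | _ => False
  end.

Section Semantics.
Variables (Sigma : finType) (M : auxPDA Sigma).

Record config : Type := Config {
  cstate : state M;
  cstack : seq (psym M);
  ctape : {ffun 'I_(nwork M).+1 -> tape (tsym M)}
}.

Definition fires (d : transition (state M) (psym M) (tsym M) (nwork M).+1)
    (x y : config) : Prop :=
  let: (p, sg, t, q) := d in
  [/\ cstate x = p, cstate y = q, stack_step sg (cstack x) (cstack y) &
      forall i, tape_step (t i) (ctape x i) (ctape y i)].

Definition step (x y : config) : Prop := exists2 d, d \in delta M & fires d x y.

Definition input_cell (w : seq Sigma) (i : int) : tsym M :=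
  match i with
  | Posz j => nth (blank M) (map (@emb _ M) w) j
  | Negz _ => blank M
  end.

Definition init (w : seq Sigma) : config :=
  Config (start M) [:: bottom M]
    [ffun i => Tape (if i == ord0 then input_cell w else fun=> blank M) 0].

Fixpoint computation (x : config) (s : seq config) : Prop :=
  if s is y :: s' then step x y /\ computation y s' else True.

(* An accepting computation on [w] is [init w :: s]; it takes [size s] steps. *)
Definition accepting (w : seq Sigma) (s : seq config) : Prop :=
  computation (init w) s /\ cstate (last (init w) s) \in final M.

Definition language : set (seq Sigma) := fun w => exists s, accepting w s.

(* The number of work-tape cells visited; a tape triple only inspects cells
   that the head visits in making the move. *)
Definition space (s : seq config) : nat :=
  (\sum_(i < (nwork M).+1 | i != ord0)
     size (undup [seq head (ctape x i) | x <- s]))%N.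

(* Every accepted input has an accepting computation within both bounds.  Other
   computations are unconstrained: a symmetric machine can always undo and redo
   a move, so that no bound could hold for all of its computations. *)
Definition bounded (S T : nat -> nat) : Prop :=
  forall w, language w -> exists s,
    [/\ accepting w s, (space (init w :: s) <= S (size w))%N &
        (size s <= T (size w))%N].

(* The [.+1] only serves the lengths 0 and 1, where the logarithm is not
   positive. *)
Definition logspace_polytime : Prop :=
  exists c k : nat,
    bounded (fun n => c * (trunc_log 2 n).+1)%N (fun n => k * n ^ k + k)%N.

Definition is_deterministic : Prop :=
  forall x y z : config, step x y -> step x z -> y = z.

Definition is_symmetric : Prop :=
  {in delta M, forall d, inv_transition d \in delta M}.

End Semantics.

(* LogCFL and LogDCFL through their auxiliary pushdown automata: by Sudborough's
   theorem these are the languages logspace-reducible to a context-free, resp.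
   deterministic context-free, language. *)
Definition LogCFL (Sigma : finType) : set (set (seq Sigma)) := fun L =>
  exists M : auxPDA Sigma, logspace_polytime M /\ language M = L.

Definition LogDCFL (Sigma : finType) : set (set (seq Sigma)) := fun L =>
  exists M : auxPDA Sigma,
    [/\ is_deterministic M, logspace_polytime M & language M = L].

Definition SLogCFL (Sigma : finType) : set (set (seq Sigma)) := fun L =>
  exists M : auxPDA Sigma,
    [/\ is_symmetric M, logspace_polytime M & language M = L].

Arguments LogCFL : clear implicits.
Arguments LogDCFL : clear implicits.
Arguments SLogCFL : clear implicits.

(* Main.v *)
(* Delete the transitions of a deterministic machine that leave a final state,
   then close the rest under inverses.  This adds no accepted word: along a path
   of the symmetric machine to a final configuration [f], one shows backwards
   from [f] that every configuration reaches [f] by forward moves alone.  A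
   backward move from [x] to [x1] undoes a forward move from [x1] to [x]; as [f]
   has no forward move, the forward path from [x1] to [f] is nonempty, and by
   determinism its first move leads to [x]. *)
Require Import Defs.
From mathcomp Require Import all_boot ssralg ssrint.
From mathcomp Require Import boolp classical_sets.

Set Implicit Arguments.
Unset Strict Implicit.
Unset Printing Implicit Defensive.

Local Open Scope classical_set_scope.

Lemma inv_tripleK (A : Type) : involutive (@inv_triple A).
Proof. by case=> [a b [] c d|a b]. Qed.

Lemma inv_transitionK (Q P G : Type) (l : nat) :
  involutive (@inv_transition Q P G l).
Proof.
case=> [[[p sg] t] q] /=; rewrite inv_tripleK; congr (_, _, _, _).
by apply/ffunP => i; rewrite !ffunE inv_tripleK.
Qed.

Lemma read_only_inv (A : Type) (t : triple A) :
  read_only t -> read_only (inv_triple t).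
Proof. by case: t => [a b D c d [-> ->]|a b ->]. Qed.

Section Tapes.
Import GRing.Theory.
Local Open Scope ring_scope.

(** A triple records the old and the new symbols of every cell it touches, so writing the old ones
    back undoes the move. *)
Lemma tape_step_inv (G : Type) (t : triple G) (T T' : tape G) :
  tape_step t T T' -> tape_step (inv_triple t) T' T.
Proof.
(* The two cells of a shift are distinct, so neither write masks the other. *)
have neq1 (h : int) : (h == h + 1) = false.
  by rewrite -{1}[h]addr0 (inj_eq (addrI h)).
have neqN1 (h : int) : (h - 1 == h) = false.
  by rewrite -{2}[h]addr0 (inj_eq (addrI h)).
case: T => f h; case: t => [a b [] c d|a b] /=.
- move=> [fa fb ->] /=; rewrite /write addrK eqxx neq1 eqxx; split=> //.
  congr Tape; apply/funext => j.
  by case: eqP => [->//|_]; case: eqP => [->|].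
- move=> [fa fb ->] /=; rewrite /write subrK eqxx neqN1 eqxx; split=> //.
  congr Tape; apply/funext => j.
  by case: eqP => [->//|_]; case: eqP => [->|].
- move=> [fa ->] /=; rewrite /write eqxx; split=> //.
  by congr Tape; apply/funext => j; case: eqP => [->|].
Qed.

End Tapes.

(** The blank [None] overwritten by a push is the one a pop restores, so inversion exchanges the
    push and pop shapes. *)
Lemma stack_step_inv (P : Type) (sg : triple (option P)) (s s' : seq P) :
  stack_step sg s s' -> stack_step (inv_triple sg) s' s.
Proof.
by case: sg => [[a|] [b|] [] [c|] [d|]|[a|] [b|]] //= [r [-> ->]]; exists r.
Qed.

Section Symmetrization.
Variables (Sigma : finType) (M : auxPDA Sigma).

Definition halting_delta :
    {set transition (state M) (psym M) (tsym M) (nwork M).+1} :=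
  [set d in delta M | d.1.1.1 \notin final M].

Definition symmetrized_delta :
    {set transition (state M) (psym M) (tsym M) (nwork M).+1} :=
  [set d | (d \in halting_delta) || (inv_transition d \in halting_delta)].

Lemma symmetrized_delta_read_only p sg t q :
  (p, sg, t, q) \in symmetrized_delta -> read_only (t ord0).
Proof.
rewrite !inE => /orP[] /andP[dM _]; first exact: delta_read_only dM.
by move/delta_read_only: dM => /read_only_inv; rewrite ffunE inv_tripleK.
Qed.

Definition symmetrized : auxPDA Sigma :=
  @AuxPDA Sigma (state M) (psym M) (tsym M) (nwork M) (blank M) (@emb _ M)
    (bottom M) (start M) (final M) symmetrized_delta (@emb_inj _ M)
    (@emb_neq_blank _ M) symmetrized_delta_read_only.

(** Both machines have the same states, symbols and tapes, but [config] depends on the machine, so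
    configurations must be retyped. *)
Definition to_sym (x : config M) : config symmetrized :=
  @Config Sigma symmetrized (cstate x) (cstack x) (ctape x).

Definition of_sym (x : config symmetrized) : config M :=
  @Config Sigma M (cstate x) (cstack x) (ctape x).

Lemma to_sym_init w : to_sym (init M w) = init symmetrized w.
Proof. by []. Qed.

Lemma of_sym_init w : of_sym (init symmetrized w) = init M w.
Proof. by []. Qed.

Lemma fires_inv d (x y : config M) :
  fires d x y -> fires (inv_transition d) y x.
Proof.
case: d => [[[p sg] t] q] [xp yq st tp]; split=> //.
  exact: stack_step_inv st.
by move=> i; rewrite ffunE; apply: tape_step_inv.
Qed.

Lemma symmetrized_symmetric : is_symmetric symmetrized.
Proof. by move=> d; rewrite !inE inv_transitionK orbC. Qed.

Lemma step_to_sym (x y : config M) :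
  cstate x \notin final M -> step x y -> step (to_sym x) (to_sym y).
Proof.
move=> xF [d dM dxy]; exists d => //; rewrite !inE dM.
by case: d dxy {dM} => [[[p sg] t] q] [/= <- _ _ _]; rewrite xF.
Qed.

(** In both cases the nonfinal state is the source of the underlying move of [M], as moves leaving
    final states were deleted. *)
Lemma step_of_sym (x y : config symmetrized) : step x y ->
  (cstate x \notin final M /\ step (of_sym x) (of_sym y)) \/
  (cstate y \notin final M /\ step (of_sym y) (of_sym x)).
Proof.
have halting d (u v : config M) : d \in halting_delta -> fires d u v ->
    cstate u \notin final M /\ step u v.
  rewrite inE => /andP[dM dF] duv; split; last by exists d.
  by case: d duv dF {dM} => [[[p sg] t] q] [/= <-].
move=> [d]; rewrite inE => /orP[dH|dH] dxy; [left|right].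
  apply: (halting d (of_sym x) (of_sym y) dH).
  by case: d dxy {dH} => [[[p sg] t] q].
apply: (halting _ (of_sym y) (of_sym x) dH); apply: fires_inv.
by case: d dxy {dH} => [[[p sg] t] q].
Qed.

(** The run is cut at its first final configuration; all moves before it start in nonfinal states
    and hence survive the deletion. *)
Lemma computation_to_sym (x : config M) s :
  computation x s -> cstate (last x s) \in final M ->
  exists n, computation (to_sym x) (map to_sym (take n s)) /\
            cstate (last x (take n s)) \in final M.
Proof.
elim: s x => [|y s IH] x /=; first by move=> _ xF; exists 0.
move=> [xy ys] lF; have [xF|xF] := boolP (cstate x \in final M).
  by exists 0.
have [n [cn ln]] := IH y ys lF.
by exists n.+1; split=> //=; split=> //; apply: step_to_sym.
Qed.

Lemma computation_of_sym (x : config symmetrized) s :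
  is_deterministic M -> computation x s -> cstate (last x s) \in final M ->
  exists t, computation (of_sym x) t /\
            last (of_sym x) t = of_sym (last x s).
Proof.
move=> detM; elim: s x => [|x1 s IH] x /=; first by exists [::].
move=> [xx1 x1s] lF; have [t [ct lt]] := IH x1 x1s lF.
have [[_ fwd]|[x1F bwd]] := step_of_sym xx1.
  by exists (of_sym x1 :: t).
(* An empty forward path would make [x1] agree with the final configuration, against [x1F]. *)
case: t ct lt => [_ /= eq1|x' t /= [x1x' ct] lt].
  by case: eq1 => eq1 _ _; rewrite eq1 lF in x1F.
(* Determinism identifies [x'] with [of_sym x], so the tail of the path already starts at [x]. *)
by rewrite (detM _ _ _ x1x' bwd) in ct lt; exists t.
Qed.

Lemma accepting_to_sym w s : @accepting Sigma M w s ->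
  exists n, @accepting Sigma symmetrized w (map to_sym (take n s)).
Proof.
move=> [cs lF]; have [n [cn ln]] := computation_to_sym cs lF.
by exists n; split; rewrite -to_sym_init ?last_map.
Qed.

Lemma language_symmetrized :
  is_deterministic M -> language symmetrized = language M.
Proof.
move=> detM; apply/seteqP; split=> w [s accs].
  case: accs => cs lF; have [t [ct lt]] := computation_of_sym detM cs lF.
  by rewrite of_sym_init in ct lt; exists t; split; rewrite // lt.
by have [n accn] := accepting_to_sym accs; exists (map to_sym (take n s)).
Qed.

(** On each work tape, the head positions of the truncated run are among those of the full run. *)
Lemma space_to_sym (x : config M) s n :
  space (to_sym x :: map to_sym (take n s)) <= space (x :: s).
Proof.
apply: leq_sum => i _; apply: uniq_leq_size; first exact: undup_uniq.
move=> h; rewrite !mem_undup /= !inE -map_comp map_take => /orP[->//|].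
by move/mem_take => hs; rewrite [X in _ || X]hs orbT.
Qed.

Lemma bounded_symmetrized S T :
  is_deterministic M -> bounded M S T -> bounded symmetrized S T.
Proof.
move=> detM bM w; rewrite language_symmetrized // => /bM[s [accs sS sT]].
have [n accn] := accepting_to_sym accs; exists (map to_sym (take n s)).
split=> //; first by apply: leq_trans sS; rewrite -to_sym_init space_to_sym.
by apply: leq_trans sT; rewrite size_map size_take_min geq_minr.
Qed.

End Symmetrization.

Theorem theorem2 (Sigma : finType) :
  LogDCFL Sigma `<=` SLogCFL Sigma /\ SLogCFL Sigma `<=` LogCFL Sigma.
Proof.
split=> L [M].
  move=> [detM [c [k bM]] <-]; exists (symmetrized M); split.
  - exact: symmetrized_symmetric.
  (* The constants carry over: the witness is a truncation of a bounded run of [M]. *)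
  - by exists c, k; apply: bounded_symmetrized.
  - exact: language_symmetrized.
by move=> [_ bM <-]; exists M.
Qed.
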